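(* Let $H$ be a real or complex Hilbert space and let $D\subset S(H)$ be a dictionary. (i) If $\rho(D_k)>0$ for some $k\in\mathbb{N}$, then for every $x\in H$ $$\sigma_m(x)\le |x|\,\bigl(1-\rho(D_k)^2\bigr)^{[m/k]/2},\qquad m=0,1,2,\dots$$ (ii) If $\rho(D_k)=0$ for all $k\in\mathbb{N}$, then for every sequence of real numbers $\alpha_m\to 0$ there exists $x\in H$ such that $\sigma_m(x)\ge\alpha_m$ for all $m=0,1,2,\dots$
   Context: $\mathbb{N}=\{1,2,\dots\}$. $H$ has norm $|\cdot|$ and scalar product $\langle\cdot,\cdot\rangle$; $S(H)$ is its unit sphere. A dictionary is a subset $D\subset S(H)$ with $\overline{\mathrm{span}}\,D=H$. For $m\in\mathbb{N}$, $\Sigma_m(D)=\{\sum_{k=1}^m\lambda_k g_k:\ \lambda_k \text{ scalars},\ g_k\in D\}$. For $x\in H$, the $m$-term deviations are $\sigma_m(x)=\mathrm{dist}(x,\Sigma_m(D))$ for $m\in\mathbb{N}$, and $\sigma_0(x)=|x|$. Put $D_m=\Sigma_m(D)\cap S(H)$ for $m\in\mathbb{N}$, and for a dictionary $E$ put $\rho(E)=\inf_{x\in S(H)}\sup\{|\langle x,g\rangle|:\ g\in E\}$. $[t]$ denotes the integer part of $t$. *)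

(* Defs.v *)
From HB Require Import structures.
From mathcomp Require Import all_boot all_order all_algebra.
From mathcomp Require Import sesquilinear complex.
From mathcomp Require Import all_classical all_reals all_analysis.
Import Order.TTheory GRing.Theory Num.Theory.
Import numFieldNormedType.Exports.

Set Implicit Arguments.
Unset Strict Implicit.
Unset Printing Implicit Defensive.

Local Open Scope classical_set_scope.
Local Open Scope ring_scope.

Variant scalar_kind := RealScalars | ComplexScalars.

Definition scalar_field (R : realType) (s : scalar_kind) : numFieldType :=
  match s with
  | RealScalars => R
  | ComplexScalars => R[i]
  end.

Definition scalar_re (R : realType) (s : scalar_kind) : scalar_field R s -> R :=
  match s with
  | RealScalars => fun a => a
  | ComplexScalars => fun a => complex.Re a
  end.

Definition scalar_conj (R : realType) (s : scalar_kind) :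
    scalar_field R s -> scalar_field R s :=
  match s with
  | RealScalars => fun a => a
  | ComplexScalars => fun a => conjc a
  end.

(* The norm [`|v|] of the library takes its values in the scalar field, and
   [R[i]] is only partially ordered; [rnorm v] is the same nonnegative number,
   seen as an element of [R], where infima and suprema are available. It is
   used both for vectors and for the modulus of scalars. *)
Definition rnorm (R : realType) (s : scalar_kind)
    (V : normedZmodType (scalar_field R s)) (v : V) : R :=
  scalar_re `|v|.

Section Dictionaries.
Context (R : realType) (s : scalar_kind).
Context (H : completeNormedModType (scalar_field R s)).
Implicit Types (D E : set H) (x : H) (m : nat).

Definition unit_sphere : set H := [set x | `|x| = 1].

(* The [g i] need not be distinct, and [Sigma_terms D 0 = [set 0]]. *)
Definition Sigma_terms D m : set H :=
  [set x | exists (lam : 'I_m -> scalar_field R s) (g : 'I_m -> H),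
     (forall i, D (g i)) /\ x = \sum_(i < m) lam i *: g i].

Definition lin_span D : set H := \bigcup_m Sigma_terms D m.

Definition dictionary D : Prop :=
  D `<=` unit_sphere /\ closure (lin_span D) = setT.

Definition distance x (A : set H) : R := inf [set rnorm (x - y) | y in A].

Definition sigma D m x : R :=
  if m is 0%N then rnorm x else distance x (Sigma_terms D m).

Definition Dterms D m : set H := Sigma_terms D m `&` unit_sphere.

(* Extended-real valued, so that the infimum over an empty unit sphere (when
   [H] is the null space) is [+oo] and not the default value [0]. *)
Definition rho (ip : {dot H for @scalar_conj R s}) E : \bar R :=
  ereal_inf [set ereal_sup [set (rnorm (ip x g))%:E | g in E]
            | x in unit_sphere].

End Dictionaries.

(* Main.v *)
Require Import Defs.
From HB Require Import structures.
From mathcomp Require Import all_boot all_order all_algebra.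
From mathcomp Require Import sesquilinear complex.
From mathcomp Require Import all_classical all_reals all_analysis.
From mathcomp Require Import lra.
Import Order.TTheory GRing.Theory Num.Theory.
Import numFieldNormedType.Exports.

Set Implicit Arguments.
Unset Strict Implicit.
Unset Printing Implicit Defensive.

Local Open Scope classical_set_scope.
Local Open Scope ring_scope.

(** Let S_m be the set of m-term combinations of elements of D. Two facts are
used throughout: S_m is stable under scaling, and S_m + S_n is contained in
S_{m+n}.

The geometric input is Pythagoras' identity for the projection onto the line
of a unit vector g, |x - <x,g> g|^2 = |x|^2 - |<x,g>|^2 ([rnorm_projection]).
Since S_k is the union of the lines spanned by the unit vectors of S_k, it
gives dist(x, S_k)^2 = |x|^2 - sup_g |<x,g>|^2, the supremum being taken over
these unit vectors; [distance_Dterms] and [le_rnorm_Sigma_terms] are the two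
inequalities. So rho(D_k) measures how far from S_k a unit vector can be.

Part (i). The above gives dist(x, S_k) <= q |x| with q^2 = 1 - rho(D_k)^2
([distance_contraction]). Applied to x - y for y in S_n, this shows that
sigma_{n+k}(x) <= q |x - y|, hence sigma_{n+k}(x) <= q sigma_n(x)
([sigma_contraction]); iterate, and use that sigma_m decreases with m.

Part (ii). If rho(D_N) = 0 for all N, then for every N some unit vector is
almost orthogonal to D_N, hence almost at distance 1 from S_N; by density it
can be moved into the span of D, so that it becomes a finite combination
([exists_far_vector]). Then x is a lacunary series sum_j c_j w_j with
c_j = C 8^-j and |w_j| <= 2. Choose n_j such that alpha_m <= c_{j+1} for
m >= n_j, and let L_j be a number of terms that suffices for the sum of the
first j summands; w_j is taken far from S_N with N = n_{j+1} + L_j. For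
m < n_{j+1}, approximating x by m terms amounts, up to the tail beyond j, to
approximating c_j w_j by m + L_j terms, which leaves an error of at least
c_j / 2. The tail is at most 2 c_j / 7, so that sigma_m(x) >= c_{j+1}, which
dominates alpha_m for n_j <= m < n_{j+1} ([slow_deviations]). *)

(** * The real-valued norm *)

Section RealNorm.
Context {R : realType} {s : scalar_kind}.
Local Notation K := (scalar_field R s).

(** The embedding of the reals in the scalar field. With [normr_rnorm] it turns
statements about the norm of the library into statements about [rnorm] that
hold for both kinds of scalars, without distinguishing cases. *)
Definition scalar_of_real : R -> K :=
  match s return R -> scalar_field R s with
  | RealScalars => fun r => r
  | ComplexScalars => fun r => r%:C
  end%C.

Lemma scalar_of_realK : cancel scalar_of_real (@scalar_re R s).
Proof. by rewrite /scalar_of_real; case: s. Qed.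

Lemma scalar_reK (a : K) : 0 <= a -> scalar_of_real (scalar_re a) = a.
Proof.
rewrite /scalar_of_real; move: a; case: s => //= -[a b].
by rewrite lecE /= => /andP[/eqP -> _].
Qed.

Lemma scalar_of_realD : {morph scalar_of_real : x y / x + y}.
Proof. by rewrite /scalar_of_real; case: s => //= x y; rewrite rmorphD. Qed.

Lemma scalar_of_realM : {morph scalar_of_real : x y / x * y}.
Proof. by rewrite /scalar_of_real; case: s => //= x y; rewrite rmorphM. Qed.

Lemma scalar_of_real0 : scalar_of_real 0 = 0.
Proof. by rewrite /scalar_of_real; case: s. Qed.

Lemma scalar_of_real1 : scalar_of_real 1 = 1.
Proof. by rewrite /scalar_of_real; case: s. Qed.

Lemma scalar_of_real_le : {mono scalar_of_real : x y / x <= y}.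
Proof. by rewrite /scalar_of_real; case: s => //= x y; rewrite lecR. Qed.

Lemma scalar_of_real_lt : {mono scalar_of_real : x y / x < y}.
Proof. exact: (leW_mono scalar_of_real_le). Qed.

Lemma scalar_of_real_inj : injective scalar_of_real.
Proof. exact: can_inj scalar_of_realK. Qed.

Lemma scalar_re_gt0 (e : K) : 0 < e -> 0 < scalar_re e.
Proof.
by move=> e0; rewrite -scalar_of_real_lt scalar_of_real0 scalar_reK// ltW.
Qed.

Lemma mulr_scalar_conj (a : K) : a * scalar_conj a = `|a| ^+ 2.
Proof.
move: a; case: s => /= a; first by rewrite -normrX ger0_norm ?sqr_ge0.
by rewrite normCK.
Qed.

Lemma normr_rnorm (V : normedZmodType K) (v : V) :
  `|v| = scalar_of_real (rnorm v).
Proof. by rewrite /rnorm scalar_reK. Qed.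

Lemma rnorm_ge0 (V : normedZmodType K) (v : V) : 0 <= rnorm v.
Proof. by rewrite -scalar_of_real_le -normr_rnorm scalar_of_real0. Qed.

Lemma rnormD (V : normedZmodType K) (u v : V) :
  rnorm (u + v) <= rnorm u + rnorm v.
Proof.
by rewrite -scalar_of_real_le scalar_of_realD -!normr_rnorm ler_normD.
Qed.

Lemma rnormN (V : normedZmodType K) (v : V) : rnorm (- v) = rnorm v.
Proof. by rewrite /rnorm normrN. Qed.

Lemma rnorm_sub (V : normedZmodType K) (u v : V) :
  rnorm (u - v) = rnorm (v - u).
Proof. by rewrite -rnormN opprB. Qed.

Lemma rnorm_eq0 (V : normedZmodType K) (v : V) : (rnorm v == 0) = (v == 0).
Proof.
rewrite -(inj_eq scalar_of_real_inj) -normr_rnorm scalar_of_real0.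
by rewrite normr_eq0.
Qed.

Lemma rnorm0 (V : normedZmodType K) : rnorm (0 : V) = 0.
Proof. by apply/eqP; rewrite rnorm_eq0. Qed.

Lemma rnorm1P (V : normedZmodType K) (v : V) : `|v| = 1 <-> rnorm v = 1.
Proof.
rewrite normr_rnorm; split=> [h|->]; last by rewrite scalar_of_real1.
by apply: scalar_of_real_inj; rewrite h scalar_of_real1.
Qed.

Lemma rnormZ (V : normedModType K) (a : K) (v : V) :
  rnorm (a *: v) = rnorm a * rnorm v.
Proof.
apply: scalar_of_real_inj.
by rewrite scalar_of_realM -!normr_rnorm normrZ.
Qed.

Lemma rnorm_of_real (r : R) : 0 <= r -> rnorm (scalar_of_real r : K) = r.
Proof.
move=> r0; rewrite /rnorm ger0_norm ?scalar_of_realK//.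
by rewrite -scalar_of_real0 scalar_of_real_le.
Qed.

Lemma rnorm_lt_re (V : normedZmodType K) (v : V) (e : K) : 0 <= e ->
  (rnorm v < scalar_re e) = (`|v| < e).
Proof.
by move=> e0; rewrite -scalar_of_real_lt -normr_rnorm scalar_reK.
Qed.

End RealNorm.

(** * Projection onto a line *)

Section Projection.
Context {R : realType} {s : scalar_kind}.
Context {H : completeNormedModType (scalar_field R s)}.
Context (ip : {dot H for @scalar_conj R s}).
Context (ip_norm : forall x : H, ip x x = `|x| ^+ 2).

(** Pythagoras: the residual u is orthogonal to [g], so that
<u,u> = <u,x> = <x,x> - <x,g> <g,x>. *)
Lemma rnorm_projection (x g : H) : rnorm g = 1 ->
  rnorm (x - ip x g *: g) ^+ 2 = rnorm x ^+ 2 - rnorm (ip x g) ^+ 2.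
Proof.
move=> /rnorm1P g1; set b := ip x g; set u := x - b *: g.
have ug : ip u g = 0.
  by rewrite /u linearBl/= linearZl_LR/= ip_norm g1 expr1n mulr1 subrr.
have gx : ip g x = scalar_conj b.
  by rewrite (@hermitian_subproof _ _ _ _ ip) expr0 mul1r.
have uu : ip u u = ip x x - b * scalar_conj b.
  rewrite [in X in ip _ X]/u linearBr/= linearZr_LR/= ug mulr0 subr0.
  by rewrite /u linearBl/= linearZl_LR/= gx.
apply: (@scalar_of_real_inj _ s).
move: uu; rewrite mulr_scalar_conj !ip_norm !normr_rnorm !expr2.
rewrite -!scalar_of_realM => /eqP; rewrite -subr_eq opprK -scalar_of_realD.
by move=> /eqP/scalar_of_real_inj<-; rewrite addrK.
Qed.

(** Subtracting [a *: g] does not change the residual of the projection onto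
the line of [g], and the residual is no longer than the vector itself. *)
Lemma rnorm_approx (x g : H) (a : scalar_field R s) : rnorm g = 1 ->
  rnorm x ^+ 2 - rnorm (ip x g) ^+ 2 <= rnorm (x - a *: g) ^+ 2.
Proof.
move=> g1; have /rnorm1P ng1 := g1.
have -> : rnorm x ^+ 2 - rnorm (ip x g) ^+ 2
        = rnorm (x - a *: g) ^+ 2 - rnorm (ip (x - a *: g) g) ^+ 2.
  rewrite -!rnorm_projection//; congr (rnorm _ ^+ 2).
  rewrite linearBl/= linearZl_LR/= ip_norm ng1 expr1n mulr1.
  by rewrite scalerBl opprB addrA subrK.
by rewrite lerBlDr lerDl sqr_ge0.
Qed.

Lemma rnorm_ip_le (x g : H) : rnorm g = 1 -> rnorm (ip x g) <= rnorm x.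
Proof.
move=> g1; rewrite -(ler_pXn2r (n := 2))// ?nnegrE ?rnorm_ge0//.
by rewrite -subr_ge0 -rnorm_projection// sqr_ge0.
Qed.

End Projection.

(** * Combinations of m elements and the distance to them *)

Section Sparse.
Context {R : realType} {s : scalar_kind}.
Context {H : completeNormedModType (scalar_field R s)}.
Implicit Types (D : set H) (x y z : H).

Lemma Sigma_terms0 D : Sigma_terms D 0 = [set 0].
Proof.
apply/seteqP; split=> [x [lam [g [_ ->]]]|x ->] /=; first by rewrite big_ord0.
exists (fun=> 0), (fun=> 0); split=> [[]//|].
by rewrite big_ord0.
Qed.

Lemma Sigma_termsD D m n x y :
  Sigma_terms D m x -> Sigma_terms D n y -> Sigma_terms D (m + n) (x + y).
Proof.
move=> [lam [g [Dg ->]]] [mu [h [Dh ->]]].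
exists (fun i : 'I_(m + n) =>
  match fintype.split i with inl j => lam j | inr j => mu j end).
exists (fun i : 'I_(m + n) =>
  match fintype.split i with inl j => g j | inr j => h j end).
split=> [i|]; first by case: fintype.split.
rewrite big_split_ord; congr (_ + _); apply: eq_bigr => i _.
  by rewrite (unsplitK (inl i)).
by rewrite (unsplitK (inr i)).
Qed.

Lemma Sigma_termsZ D m a x : Sigma_terms D m x -> Sigma_terms D m (a *: x).
Proof.
move=> [lam [g [Dg ->]]]; exists (fun i => a * lam i), g; split=> //.
by rewrite scaler_sumr; apply: eq_bigr => i _; rewrite scalerA.
Qed.

Lemma Sigma_terms_zero D m : D !=set0 -> Sigma_terms D m 0.
Proof.
move=> [g Dg]; exists (fun=> 0), (fun=> g); split=> //.
by rewrite big1// => i _; rewrite scale0r.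
Qed.

(** An element of [D] is needed as a dummy, to be taken with coefficient 0. *)
Lemma Sigma_terms_le D m n : D !=set0 -> (m <= n)%N ->
  Sigma_terms D m `<=` Sigma_terms D n.
Proof.
move=> D0 mn x Dx; rewrite -(subnKC mn) -[x]addr0.
by apply: Sigma_termsD => //; exact: Sigma_terms_zero.
Qed.

Lemma distance_le (A : set H) x y : A y -> distance x A <= rnorm (x - y).
Proof.
move=> Ay; apply: ge_inf; last by exists y.
by exists 0 => _ [z _ <-]; exact: rnorm_ge0.
Qed.

Lemma le_distance (A : set H) x (c : R) : A !=set0 ->
  (forall y, A y -> c <= rnorm (x - y)) -> c <= distance x A.
Proof.
move=> [y Ay] h; apply: lb_le_inf; first by exists (rnorm (x - y)), y.
by move=> _ [z Az <-]; exact: h.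
Qed.

Lemma sigmaE D m x : sigma D m x = distance x (Sigma_terms D m).
Proof.
case: m => //=; rewrite Sigma_terms0; apply/eqP; rewrite eq_le.
rewrite le_distance/=; last by move=> y ->; rewrite subr0.
  by rewrite -{2}[x]subr0 distance_le.
by exists 0.
Qed.

Lemma distance_set0 x : distance x (set0 : set H) = 0.
Proof. by rewrite /distance image_set0 inf0. Qed.

End Sparse.

(** * Geometric decay of the deviations *)

Section Deviations.
Context {R : realType} {s : scalar_kind}.
Context {H : completeNormedModType (scalar_field R s)}.
Context (ip : {dot H for @scalar_conj R s}).
Context (ip_norm : forall x : H, ip x x = `|x| ^+ 2).
Context (D : set H).
Implicit Types (x y z : H).

Lemma Dterms_rnorm m g : Dterms D m g -> rnorm g = 1.
Proof. by move=> [_ /rnorm1P]. Qed.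

Lemma Sigma_terms_polar m y : Sigma_terms D m y -> y != 0 ->
  exists2 g, Dterms D m g & y = scalar_of_real (rnorm y) *: g.
Proof.
move=> Dy y0; have ny : rnorm y != 0 by rewrite rnorm_eq0.
exists (scalar_of_real (rnorm y)^-1 *: y); last first.
  by rewrite scalerA -scalar_of_realM mulfV// scalar_of_real1 scale1r.
split; first exact: Sigma_termsZ.
apply/rnorm1P; rewrite rnormZ rnorm_of_real ?invr_ge0 ?rnorm_ge0//.
by rewrite mulVf.
Qed.

(** Every nonzero [y] in [Sigma_terms D m] lies on the line of a [g] in
[Dterms D m], and no point of this line is closer to [x] than the projection
of [x]. *)
Lemma le_rnorm_Sigma_terms m x (e : R) :
  (forall g, Dterms D m g -> rnorm (ip x g) <= e) ->
  forall y, Sigma_terms D m y -> rnorm x ^+ 2 - e ^+ 2 <= rnorm (x - y) ^+ 2.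
Proof.
move=> he y Dy; have [->|y0] := eqVneq y 0.
  by rewrite subr0 lerBlDr lerDl sqr_ge0.
have [g Dg ->] := Sigma_terms_polar Dy y0.
apply: le_trans (rnorm_approx ip_norm _ _ (Dterms_rnorm Dg)).
by rewrite lerB// ler_pXn2r ?nnegrE ?rnorm_ge0// ?he//
  (le_trans _ (he _ Dg))// rnorm_ge0.
Qed.

Lemma distance_Dterms m x g : Dterms D m g ->
  distance x (Sigma_terms D m) ^+ 2 <= rnorm x ^+ 2 - rnorm (ip x g) ^+ 2.
Proof.
move=> Dg; rewrite -(rnorm_projection ip_norm)//; last exact: Dterms_rnorm Dg.
have Sg : Sigma_terms D m (ip x g *: g) by apply: Sigma_termsZ; case: Dg.
rewrite ler_pXn2r ?nnegrE ?rnorm_ge0 ?distance_le//.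
by apply: le_distance => [|y _]; [exists (ip x g *: g)|exact: rnorm_ge0].
Qed.

Section Contraction.
Context (k : nat).
Let r := fine (rho ip (Dterms D k)).
Let q := Num.sqrt (1 - r ^+ 2).

(** For a unit vector at distance d from S_k every |<x,g>| is at most
sqrt(1 - d^2), which therefore bounds the infimum rho as well; the general case
follows by scaling. *)
Lemma distance_contraction x : D !=set0 -> (0 < rho ip (Dterms D k))%E ->
  distance x (Sigma_terms D k) <= q * rnorm x.
Proof.
move=> D0 rho0; set d := distance _ _.
have d0 : 0 <= d.
  apply: le_distance => [|y _]; last exact: rnorm_ge0.
  by exists 0; exact: Sigma_terms_zero.
have dx : d <= rnorm x.
  rewrite -[in leRHS](subr0 x); apply: distance_le; exact: Sigma_terms_zero.
have [x0|x0] := eqVneq x 0.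
  by rewrite (le_trans dx)// x0 rnorm0 mulr0.
have nx : 0 < rnorm x by rewrite lt_def rnorm_eq0 x0 rnorm_ge0.
pose e := Num.sqrt (1 - (d / rnorm x) ^+ 2).
have e2 : e ^+ 2 = 1 - (d / rnorm x) ^+ 2.
  rewrite sqr_sqrtr// subr_ge0 exprn_ile1 ?divr_ge0 ?rnorm_ge0//.
  by rewrite ler_pdivrMr// mul1r.
have rhoe : (rho ip (Dterms D k) <= e%:E)%E.
  apply: ge_ereal_inf; exists (ereal_sup [set (rnorm (ip
    (scalar_of_real (rnorm x)^-1 *: x) g))%:E | g in Dterms D k]).
    exists (scalar_of_real (rnorm x)^-1 *: x) => //.
    apply/rnorm1P; rewrite rnormZ rnorm_of_real ?invr_ge0 ?rnorm_ge0//.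
    by rewrite mulVf// gt_eqF.
  apply: ge_ereal_sup => _ [g Dg <-]; rewrite lee_fin.
  rewrite linearZl_LR/=.
  rewrite -(ler_pXn2r (n := 2))// ?nnegrE ?rnorm_ge0 ?sqrtr_ge0// e2.
  have := @rnormZ R s _ (scalar_of_real (rnorm x)^-1)
    (ip x g : (scalar_field R s)^o).
  rewrite rnorm_of_real ?invr_ge0 ?rnorm_ge0// => ->.
  have := distance_Dterms x Dg; rewrite -/d => h.
  rewrite !exprMn exprVn -(ler_pM2l (x := rnorm x ^+ 2)) ?exprn_gt0//.
  rewrite mulrBr mulr1 mulrA mulfV ?mul1r ?sqrf_eq0 ?gt_eqF//.
  rewrite mulrCA mulfV ?mulr1 ?sqrf_eq0 ?gt_eqF//.
  by rewrite lerBrDl -lerBrDr.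
have rE : rho ip (Dterms D k) = r%:E.
  rewrite /r fineK// fin_numElt (lt_trans _ rho0)//=.
  by rewrite (le_lt_trans rhoe)// ltry.
have r0 : 0 < r by rewrite -lte_fin -rE.
have re : r <= e by rewrite -lee_fin -rE.
have : r ^+ 2 <= e ^+ 2 by rewrite ler_pXn2r ?nnegrE// ltW// (lt_le_trans r0).
rewrite e2 lerBrDl addrC -lerBrDl => re2.
have q0 : 0 <= 1 - r ^+ 2 by rewrite (le_trans _ re2)// sqr_ge0.
rewrite -ler_pdivrMr// -(ler_pXn2r (n := 2))// ?nnegrE ?sqrtr_ge0//.
  by rewrite sqr_sqrtr.
by rewrite divr_ge0// rnorm_ge0.
Qed.

(** A combination of [n] terms leaves a residual that [k] further terms reduce
by the factor [q]. *)
Lemma sigma_contraction n x : D !=set0 -> (0 < rho ip (Dterms D k))%E ->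
  sigma D (n + k) x <= q * sigma D n x.
Proof.
move=> D0 rho0; rewrite !sigmaE.
have step y : Sigma_terms D n y ->
    distance x (Sigma_terms D (n + k)) <= q * rnorm (x - y).
  move=> Dy; apply: le_trans (distance_contraction (x - y) D0 rho0).
  apply: le_distance => [|z Dz]; first by exists 0; exact: Sigma_terms_zero.
  by rewrite -addrA -opprD; apply: distance_le; exact: Sigma_termsD.
(* For [q = 0] one cannot divide by [q] to pass to the infimum over [y], but
   then a single [y] suffices. *)
have [q0|q0] := eqVneq q 0.
  rewrite q0 mul0r; have := step 0; rewrite q0 mul0r; apply.
  exact: Sigma_terms_zero.
have qgt0 : 0 < q by rewrite lt_def q0 sqrtr_ge0.
rewrite mulrC -ler_pdivrMr//.
apply: le_distance => [|y Dy]; first by exists 0; exact: Sigma_terms_zero.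
by rewrite ler_pdivrMr// mulrC step.
Qed.

Lemma sigma_geometric n x : D !=set0 -> (0 < rho ip (Dterms D k))%E ->
  sigma D (n * k) x <= q ^+ n * rnorm x.
Proof.
move=> D0 rho0; elim: n => [|n IHn]; first by rewrite mul0n expr0 mul1r.
rewrite mulSnr exprS -mulrA (le_trans (sigma_contraction _ _ D0 rho0))//.
by rewrite ler_wpM2l// sqrtr_ge0.
Qed.

End Contraction.

Lemma sigma_le m n x : D !=set0 -> (m <= n)%N -> sigma D n x <= sigma D m x.
Proof.
move=> D0 mn; rewrite !sigmaE; apply: le_distance => [|y Dy].
  by exists 0; exact: Sigma_terms_zero.
by apply: distance_le; exact: Sigma_terms_le Dy.
Qed.

(** Cauchy-Schwarz; thus 1 - rho^2 is nonnegative, which the identification of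
its power n/2 with the n-th power of its square root requires. *)
Lemma rho_le1 k g : D g -> D `<=` @unit_sphere R s H ->
  (rho ip (Dterms D k) <= 1)%E.
Proof.
move=> Dg D1; apply: ge_ereal_inf.
exists (ereal_sup [set (rnorm (ip g h))%:E | h in Dterms D k]).
  by exists g => //; exact: D1.
apply: ge_ereal_sup => _ [h Dh <-]; rewrite lee_fin.
have /rnorm1P <- := D1 _ Dg.
exact: (rnorm_ip_le ip_norm _ (Dterms_rnorm Dh)).
Qed.

Lemma sigma_rho k x m :
  D `<=` @unit_sphere R s H -> (0 < rho ip (Dterms D k))%E ->
  sigma D m x <= rnorm x * (1 - fine (rho ip (Dterms D k)) ^+ 2)
                   `^ ((m %/ k)%N%:R / 2).
Proof.
move=> D1 rho0.
have [De|/set0P D0] := eqVneq D set0.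
  (* For an empty [D] and [m > 0] the distance is an infimum over the empty set,
     which is 0 by convention. *)
  case: m => [|m]; first by rewrite div0n mul0r powRr0 mulr1.
  rewrite sigmaE (_ : Sigma_terms _ _ = set0) ?distance_set0.
    by rewrite mulr_ge0 ?rnorm_ge0 ?powR_ge0.
  by rewrite De -subset0 => y [lam [g [/(_ ord0)]]].
have [g Dg] := D0; have rho1 := rho_le1 k Dg D1.
have [r rE] : exists r, rho ip (Dterms D k) = r%:E.
  by exists (fine (rho ip (Dterms D k))); rewrite fineK// fin_numElt
    (lt_trans _ rho0)//= (le_lt_trans rho1)// ltry.
have := sigma_geometric (m %/ k) x D0 rho0.
move: rho0 rho1; rewrite rE lte_fin lee_fin /= => r0 r1.
have q0 : 0 <= 1 - r ^+ 2 by rewrite subr_ge0 exprn_ile1// ltW.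
rewrite mulrC [_ / 2]mulrC powRrM powR12_sqrt// powR_mulrn ?sqrtr_ge0//.
by apply: le_trans; apply: sigma_le => //; exact: leq_divM.
Qed.

(** The bounds 2 and 1/2 are crude on purpose: a unit vector [u] with
sup |<u,g>| < 1/2 has distance at least sqrt(3/4) > 3/4 to S_m, and moving it
by less than 1/4 into the dense span costs at most 1/4 in each bound. *)
Lemma exists_far_vector m : closure (lin_span D) = setT ->
  rho ip (Dterms D m) = 0%E ->
  exists w : H, [/\ lin_span D w, rnorm w <= 2 &
    forall y, Sigma_terms D m y -> 1 / 2 <= rnorm (w - y)].
Proof.
move=> dense rho0.
have half0 : (rho ip (Dterms D m) < (1 / 2)%:E)%E by rewrite rho0 lte_fin; lra.
have [_ [u /rnorm1P u1 <-] supu] := ereal_inf_lt half0.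
have ule g : Dterms D m g -> rnorm (ip u g) <= 1 / 2.
  move=> Dg; rewrite -lee_fin; apply: le_trans (ltW supu).
  by apply: ereal_sup_ubound; exists g.
have far y : Sigma_terms D m y -> 3 / 4 <= rnorm (u - y).
  move=> Dy; rewrite -(ler_pXn2r (n := 2))// ?nnegrE ?rnorm_ge0//.
  apply: le_trans (le_rnorm_Sigma_terms ule Dy); rewrite u1; lra.
have e0 : 0 < (scalar_of_real (1 / 4) : scalar_field R s).
  by rewrite -scalar_of_real0 scalar_of_real_lt; lra.
have : closure (lin_span D) u by rewrite dense.
move=> /(_ _ (nbhsx_ballx u _ e0)) [w [Dw]].
rewrite -ball_normE /= -rnorm_lt_re ?(ltW e0)// scalar_of_realK => uw.
exists w; split=> // [|y Dy].
  have := rnormD (w - u) u; rewrite subrK u1 rnorm_sub; lra.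
have := rnormD (u - w) (w - y); rewrite addrA subrK.
have := far y Dy; lra.
Qed.

End Deviations.

(** * Elements with slowly decreasing deviations *)

Section Lacunary.
Context {R : realType} {s : scalar_kind}.
Context {H : completeNormedModType (scalar_field R s)}.

(** The tail from [n] on is at most the sum of 2 C 8^-i over i >= n, that is
16/7 C 8^-n. It
converges by completeness of [H]. *)
Lemma lacunary_series (C : R) (w : nat -> H) : 0 <= C ->
  (forall j, rnorm (w j) <= 2) ->
  exists x : H, forall n,
    rnorm (x - \sum_(i < n) scalar_of_real (C * 8^-1 ^+ i) *: w i)
      <= 16 / 7 * (C * 8^-1 ^+ n).
Proof.
move=> C0 w2; pose c i := C * 8^-1 ^+ i; 
pose S n := \sum_(i < n) scalar_of_real (c i) *: w i.
have cS n : c n.+1 = c n / 8 by rewrite /c exprSr mulrA.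
have c0 n : 0 <= c n by rewrite mulr_ge0// exprn_ge0.
have tail p n : rnorm (S (n + p)%N - S n) <= 16 / 7 * c n.
  elim: p n => [|p IHp] n.
    by rewrite addn0 subrr rnorm0 mulr_ge0.
  have Sn : S n.+1 - S n = scalar_of_real (c n) *: w n.
    by rewrite /S big_ord_recr addrAC subrr add0r.
  have := rnormD (S (n.+1 + p)%N - S n.+1) (S n.+1 - S n).
  rewrite addrA subrK addSnnS => /le_trans; apply.
  rewrite -addSnnS Sn rnormZ rnorm_of_real//.
  have := IHp n.+1; rewrite cS; have := ler_wpM2l (c0 n) (w2 n); lra.
have Scauchy : cauchy (S @ \oo).
  apply: cauchy_exP => e e0; have re0 := scalar_re_gt0 e0.
  have : (16 / 7 * c n) @[n --> \oo] --> (0 : R).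
    have -> : (fun n => 16 / 7 * c n) = geometric (16 / 7 * C) 8^-1.
      by apply/funext => n; rewrite /geometric /c /= mulrA.
    by apply: cvg_geometric; rewrite ger0_norm//; lra.
  move=> /cvgrPdist_lt /(_ _ re0) [n _ /(_ n (leqnn n))] /=.
  rewrite sub0r normrN ger0_norm ?mulr_ge0// => cn.
  exists (S n), n => // m /= nm; rewrite -ball_normE /= -rnorm_lt_re ?ltW//.
  by rewrite rnorm_sub -(subnKC nm) (le_lt_trans (tail _ _)).
exists (lim (S @ \oo)) => n; rewrite -/(S n) -/(c n).
apply/ler_addgt0Pr => e e0.
have ke0 : 0 < (scalar_of_real e : scalar_field R s).
  by rewrite -scalar_of_real0 scalar_of_real_lt.
have := cvg_ball (@cauchy_cvg H _ _ Scauchy) ke0.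
move=> [m _ /(_ (n + m)%N (leq_addl _ _))] /=.
rewrite -ball_normE /= -rnorm_lt_re ?(ltW ke0)// scalar_of_realK => lime.
have := rnormD (lim (S @ \oo) - S (n + m)%N) (S (n + m)%N - S n).
rewrite addrA subrK; have := tail m n; lra.
Qed.

(** No inner product is involved: only vectors of bounded norm, in the span of
[D], that stay at a fixed distance from S_m for each [m]. *)
Lemma slow_deviations (D : set H) (alpha : nat -> R) : D !=set0 ->
  (forall m, exists w : H, [/\ lin_span D w, rnorm w <= 2 &
     forall y, Sigma_terms D m y -> 1 / 2 <= rnorm (w - y)]) ->
  alpha @ \oo --> (0 : R) ->
  exists x : H, forall m, alpha m <= sigma D m x.
Proof.
move=> D0 far_vector alpha0.
have [C C0 Calpha] : exists2 C : R, 0 < C & forall m, alpha m <= C / 8.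
  have [M Mub] := cvg_has_ub (cvgP _ alpha0).
  exists (8 * (`|M| + 1)) => [|m]; first by rewrite mulr_gt0// ltr_wpDl.
  rewrite mulrC mulKf// (le_trans (ler_norm _))//.
  rewrite (le_trans (Mub _ _)) //.
  by rewrite (le_trans (ler_norm M))// lerDl.
pose c i : R := C * 8^-1 ^+ i.
have c0 i : 0 < c i by rewrite mulr_gt0// exprn_gt0.
have cS n : c n.+1 = c n / 8 by rewrite /c exprSr mulrA.
have /choice[T alphaT] j : exists T, forall m, (T <= m)%N -> alpha m <= c j.+1.
  have /cvgrPdist_le/(_ _ (c0 j.+1))[T _ alphaT] := alpha0.
  exists T => m /alphaT /=; rewrite sub0r normrN; exact/le_trans/ler_norm.
(* [n 0 = 0] is allowed because [C] bounds all of [alpha]; adding [j] makes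
   [n] unbounded, so that every [m] is below some [n j.+1]. *)
pose n j := if j is j'.+1 then (T j + j)%N else 0%N.
have nalpha j m : (n j <= m)%N -> alpha m <= c j.+1.
  case: j => [_|j nm]; first by rewrite cS /c expr0 mulr1.
  by apply: alphaT; exact: leq_trans (leq_addr _ _) nm.
have /choice[f hf] m : exists p : H * nat, [/\ Sigma_terms D p.2 p.1,
    rnorm p.1 <= 2 & forall y, Sigma_terms D m y -> 1 / 2 <= rnorm (p.1 - y)].
  by have [w [[N _ DN] w2 far]] := far_vector m; exists (w, N).
(* [L j] terms suffice for the first [j] summands of the series. *)
pose L := fix L j := if j is j'.+1 then (L j' + (f (n j + L j')).2)%N else 0%N.
pose w j := (f (n j.+1 + L j)%N).1.
have w2 j : rnorm (w j) <= 2 by have [] := hf (n j.+1 + L j)%N.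
have [x hx] := lacunary_series (ltW C0) w2.
pose S j := \sum_(i < j) scalar_of_real (c i) *: w i.
have SL j : Sigma_terms D (L j) (S j).
  elim: j => [|j IHj]; first by rewrite /S big_ord0 Sigma_terms0.
  rewrite /S big_ord_recr; apply: Sigma_termsD => //; apply: Sigma_termsZ.
  by have [] := hf (n j.+1 + L j)%N.
exists x => m.
have exj : exists j, (m < n j.+1)%N.
  by exists m; rewrite /n (leq_trans _ (leq_addl _ _)).
case: (ex_minnP exj) => j mj jmin.
have nj : (n j <= m)%N.
  case: j mj jmin => [//|j] _ jmin; rewrite leqNgt; apply/negP => /jmin.
  by rewrite ltnn.
apply: le_trans (nalpha _ _ nj) _; rewrite sigmaE.
apply: le_distance => [|y Dy]; first by exists 0; exact: Sigma_terms_zero.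
have kc0 : scalar_of_real (c j) != 0 :> scalar_field R s.
  by rewrite -scalar_of_real0 (inj_eq scalar_of_real_inj) gt_eqF.
(* [y] takes [m] terms and [S j] takes [L j], and [w j] is far from all
   combinations of [n j.+1 + L j] terms. *)
have far : c j / 2 <= rnorm (S j.+1 - y).
  have -> : S j.+1 - y
      = scalar_of_real (c j) *: (w j - (scalar_of_real (c j))^-1 *: (y - S j)).
    rewrite scalerBr scalerA mulfV// scale1r opprB addrA /S big_ord_recr /=.
    by rewrite addrAC [in RHS]addrC addrA.
  rewrite rnormZ rnorm_of_real ?(ltW (c0 j))// ler_pM2l// -div1r.
  have [_ _] := hf (n j.+1 + L j)%N; apply; apply: Sigma_termsZ.
  apply: (@Sigma_terms_le _ _ _ D (m + L j)) => //.
    by rewrite leq_add2r ltnW.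
  by apply: Sigma_termsD => //; rewrite -scaleN1r; exact: Sigma_termsZ.
(* Tail: 16/7 c_{j+1} = 2/7 c_j, and 1/2 - 2/7 > 1/8. *)
have hxj : rnorm (x - S j.+1) <= 16 / 7 * c j.+1 := hx j.+1.
have := rnormD (S j.+1 - x) (x - y); rewrite addrA subrK (rnorm_sub (S _) x).
by move: hxj; rewrite cS; have := c0 j; lra.
Qed.

End Lacunary.

Theorem theorem1 (R : realType) (s : scalar_kind)
    (H : completeNormedModType (scalar_field R s))
    (ip : {dot H for @scalar_conj R s})
    (ip_norm : forall x : H, ip x x = `|x| ^+ 2)
    (D : set H) (D_dict : dictionary D) :
  (forall k : nat, (0 < k)%N -> (0 < rho ip (Dterms D k))%E ->
     forall (x : H) (m : nat),
       sigma D m x <=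
       rnorm x * (1 - fine (rho ip (Dterms D k)) ^+ 2)
                   `^ ((m %/ k)%N%:R / 2))
  /\
  ((forall k : nat, (0 < k)%N -> rho ip (Dterms D k) = 0%E) ->
   forall alpha : nat -> R, alpha @ \oo --> (0 : R) ->
   exists x : H, forall m : nat, alpha m <= sigma D m x).
Proof.
have [D1 Ddense] := D_dict.
split=> [k _ rho0 x m|rho0 alpha alpha0]; first exact: sigma_rho.
have D0 : D !=set0.
  apply/set0P/eqP => De.
  have : (rho ip (Dterms D 1) < 1%:E)%E by rewrite rho0// lte_fin.
  move=> /ereal_inf_lt[_ [u u1 <-] _].
  have : (rho ip (Dterms D 1) <= -oo)%E.
    apply: ge_ereal_inf; eexists; first by exists u.
    apply: ge_ereal_sup => _ [g [[lam [h [Dh _]]] _] <-].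
    by have := Dh ord0; rewrite De.
  by rewrite rho0.
apply: slow_deviations => // m.
have [w [Dw w2 far]] := exists_far_vector ip_norm Ddense (rho0 m.+1 isT).
exists w; split=> // y Dy; apply: far; exact: Sigma_terms_le Dy.
Qed.
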